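(* Let $(X,\varphi)$ be a Cantor minimal system. Suppose that a homeomorphism $f\in[\varphi]$ has clopen support and is minimal on its support. Then $f\in D([\varphi])$ and $f$ is a product of five commutators from $[\varphi]$. In particular, $\varphi\in D([\varphi])$.
   Context: A Cantor set is a (non-empty) zero-dimensional compact metric space without isolated points. $H(X)$ is the group of all homeomorphisms of $X$. A Cantor minimal system $(X,\varphi)$ is a Cantor set $X$ with $\varphi\in H(X)$ such that every orbit $Orb_\varphi(x)=\{\varphi^n(x):n\in\mathbb Z\}$ is dense in $X$. The full group $[\varphi]$ is the set of all $f\in H(X)$ with $f(x)\in Orb_\varphi(x)$ for all $x\in X$. The support of $f\in H(X)$ is $supp(f)=\{x\in X:f(x)\neq x\}$; $f$ is minimal on $supp(f)$ if the $f$-orbit of every point of $supp(f)$ is dense in $supp(f)$. A commutator from $[\varphi]$ is an element $[a,b]=aba^{-1}b^{-1}$ with $a,b\in[\varphi]$; $D([\varphi])$ is the subgroup generated by all commutators. *)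

(* Defs.v *)
From HB Require Import structures.
From mathcomp Require Import all_boot all_order all_algebra.
From mathcomp Require Import all_classical all_reals all_analysis.

Set Implicit Arguments.
Unset Strict Implicit.
Unset Printing Implicit Defensive.

Local Open Scope classical_set_scope.
Local Open Scope group_scope.

Section groups.
Context {G : groupType}.

Definition zexpg (g : G) (n : int) : G :=
  match n with Posz k => g ^+ k | Negz k => g ^- k.+1 end.

Definition subgroup (H : set G) := group_closed (mem H).

Definition subgroup_generated (S : set G) : set G := smallest subgroup S.

(* The convention is [a, b] = a b a^-1 b^-1, whereas the library's [~ a, b]
   is a^-1 b^-1 a b. *)
Definition commutators (S : set G) : set G :=
  [set a * b * a^-1 * b^-1 | a in S & b in S].

Definition derived_subgroup (S : set G) : set G :=
  subgroup_generated (commutators S).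

Lemma subgroupP (H : set G) : subgroup H <->
  [/\ H 1, forall a b, H a -> H b -> H (a * b) & forall a, H a -> H a^-1].
Proof.
split=> [[H1 HB]|[H1 HM HV]]; last first.
  split=> [|a b]; rewrite ?inE // => Ha Hb.
  by apply: HM => //; exact: HV.
have {}H1 : H 1 by have := H1; rewrite !inE.
have {}HB a b : H a -> H b -> H (a * b^-1).
  by move=> Ha Hb; have := HB a b; rewrite !inE; apply.
have HV a : H a -> H a^-1 by move=> /(HB _ _ H1); rewrite mul1g.
by split=> // a b Ha /HV /(HB _ _ Ha); rewrite invgK.
Qed.

End groups.

(* A homeomorphism is bundled with its inverse, which it determines
   (see homeo_ext). *)
Record homeo (X : topologicalType) := Homeo {
  homeo_fun :> X -> X ;
  homeo_inv : X -> X ;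
  homeo_continuous : continuous homeo_fun ;
  homeo_inv_continuous : continuous homeo_inv ;
  homeo_funK : cancel homeo_fun homeo_inv ;
  homeo_invK : cancel homeo_inv homeo_fun }.

Section homeo_group.
Context {X : topologicalType}.
Implicit Types f g h : homeo X.

Lemma homeo_ext f g : f =1 g -> f = g.
Proof.
case: f g => [f f' cf cf' fK f'K] [g g' cg cg' gK g'K] /= /funext fg.
have fg' : f' = g' by apply/funext => x; rewrite -{1}(g'K x) -fg fK.
subst g g'; by congr Homeo; exact: Prop_irrelevance.
Qed.

Definition homeo1 : homeo X :=
  @Homeo X idfun idfun (fun=> cvg_id) (fun=> cvg_id)
    (fun=> erefl) (fun=> erefl).

Definition homeoV f : homeo X :=
  Homeo (homeo_inv_continuous (h := f)) (homeo_continuous (h := f))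
    (homeo_invK f) (homeo_funK f).

Fact homeoM_subproof f g : continuous (f \o g).
Proof.
by move=> x; apply: continuous_comp; exact: homeo_continuous.
Qed.

Fact homeoMV_subproof f g : continuous (homeo_inv g \o homeo_inv f).
Proof.
by move=> x; apply: continuous_comp; exact: homeo_inv_continuous.
Qed.

Definition homeoM f g : homeo X :=
  Homeo (@homeoM_subproof f g) (@homeoMV_subproof f g)
    (can_comp (homeo_funK f) (homeo_funK g))
    (can_comp (homeo_invK g) (homeo_invK f)).

HB.instance Definition _ := gen_eqMixin (homeo X).
HB.instance Definition _ := gen_choiceMixin (homeo X).

Fact homeoMA : associative homeoM.
Proof. by move=> f g h; exact: homeo_ext. Qed.

Fact homeo1M : left_id homeo1 homeoM.
Proof. by move=> f; exact: homeo_ext. Qed.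

Fact homeoM1 : right_id homeo1 homeoM.
Proof. by move=> f; exact: homeo_ext. Qed.

Fact homeoVM : left_inverse homeo1 homeoV homeoM.
Proof. by move=> f; apply: homeo_ext => x /=; exact: homeo_funK. Qed.

Fact homeoMV : right_inverse homeo1 homeoV homeoM.
Proof. by move=> f; apply: homeo_ext => x /=; exact: homeo_invK. Qed.

HB.instance Definition _ :=
  isGroup.Build (homeo X) homeoMA homeo1M homeoM1 homeoVM homeoMV.

Lemma homeo1E x : (1 : homeo X) x = x. Proof. by []. Qed.
Lemma homeoME f g x : (f * g) x = f (g x). Proof. by []. Qed.
Lemma homeoVE f x : f^-1 x = homeo_inv f x. Proof. by []. Qed.

Definition orbit_of f (x : X) : set X := [set zexpg f n x | n in [set: int]].

Definition supp f : set X := [set x | f x != x].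

(* The orbit of a point of supp f stays in supp f, so it is dense in the
   subspace supp f iff its closure in X contains supp f. *)
Definition minimal_on_supp f :=
  forall x, supp f x -> supp f `<=` closure (orbit_of f x).

Definition full_group f : set (homeo X) :=
  [set g | forall x, orbit_of f x (g x)].

Definition minimal_homeo f := forall x, dense (orbit_of f x).

End homeo_group.

Definition cantor_set {R : realType} (X : metricType R) :=
  [set: X] !=set0 /\ cantor_like X.

Definition cantor_minimal_system {R : realType} (X : metricType R)
  (phi : homeo X) := cantor_set X /\ minimal_homeo phi.

(* Main.v *)
Require Import Defs.
From HB Require Import structures.
From mathcomp Require Import all_boot all_order all_algebra.
From mathcomp Require Import all_classical all_reals all_analysis.
From mathcomp Require Import zify.

(** Let [f] be minimal on its clopen support [Y], let [x0] be a point of [Y]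
    and [V] a small clopen neighbourhood of [x0].  The columns of points
    between two visits to [V] fill [Y], and [f] moves up the columns.  Cycling
    each column is a homeomorphism [c] of the full group, and [f * c^-1] is
    the first return map to [V]: the same kind of map, on a smaller set.

    Cycles of odd length are commutators: with [r] a square root of the cycle
    and [s] a reflection, [s] inverts [r], so that [r * r] is
    [r * s * r^-1 * s^-1].  Even cycles are odd permutations, so in columns of
    even height only the levels above the bottom one are cycled.  The cycle
    that is split off is then a commutator everywhere, and what remains of [f]
    is its first return map to [V] together with the levels number 1 of the
    even columns ([split_commutator]).  Iterating over shrinking [V] gives
    [g 0 = f] and [g n = g n.+1 * [d n, b n]], where [g n] lives on a clopen
    set [U n] that gets as small as desired.

    The sets [U n] can be carried by elements of the full group to pairwise
    disjoint sets that shrink to a point [y] ([refinement]).  No comparison of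
    invariant measures is involved: [U n] is made of two small pieces, one
    near [x0] and the other in the image of the first, and the orbit of [x0]
    enters every nonempty open subset of [Y], so that elements of the full
    group carry the pieces of a sufficiently small [U n] where they should be.
    A product of homeomorphisms acting on disjoint clopen sets that shrink to
    a point is again a homeomorphism ([glue_exists]), and it stays in the full
    group, which is defined pointwise. This makes an infinite swindle possible
    ([swindle]). The product [F] of copies of [g 1], [g 2], [g 3], ... differs
    by one commutator from the product [F1] of copies of [g 2], [g 3], ...
    placed on the same sets, while [F1] is conjugate to [F] deprived of its
    factor [g 1]. Hence a copy of [g 1] is a product of two commutators, and
    [f] of three ([three_commutators]); trivial commutators complete the five.
    *)

Set Implicit Arguments.
Unset Strict Implicit.
Unset Printing Implicit Defensive.
Local Open Scope classical_set_scope.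
Local Open Scope group_scope.

(** * Homeomorphisms, full groups and exchanges of clopen sets *)

Section homeo_basics.
Context {X : topologicalType}.
Implicit Types (f g h : homeo X) (A B U : set X) (x y : X).

Lemma homeoK g x : g^-1 (g x) = x.
Proof. exact: homeo_funK. Qed.

Lemma homeoVK g x : g (g^-1 x) = x.
Proof. exact: homeo_invK. Qed.

Lemma homeo_inj g : injective g.
Proof. exact: can_inj (homeoK g). Qed.

Lemma homeoXD g m n x : (g ^+ (m + n)) x = (g ^+ m) ((g ^+ n) x).
Proof. by rewrite expgnDr. Qed.

Lemma homeoXS g n x : (g ^+ n.+1) x = g ((g ^+ n) x).
Proof. by rewrite expgS. Qed.

Lemma homeoXSr g n x : (g ^+ n.+1) x = (g ^+ n) (g x).
Proof. by rewrite expgSr. Qed.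

Lemma homeo_nbhs g x (P : set X) : nbhs (g x) P -> nbhs x (g @^-1` P).
Proof. exact: homeo_continuous. Qed.

Lemma homeo_clopen g A : clopen A -> clopen (g @^-1` A).
Proof. by move=> cA; apply: preimage_clopen => //; exact: homeo_continuous. Qed.

Lemma near_homeo_continuous (u : X -> X) h x :
  (\forall y \near x, h y = u y) -> {for x, continuous u}.
Proof.
move=> hu; have ux := nbhs_singleton hu.
have : h @ x --> u x by rewrite -ux; exact: homeo_continuous.
exact: (cvg_trans (near_eq_cvg hu)).
Qed.

Lemma supp_fix g U x : supp g `<=` U -> ~ U x -> g x = x.
Proof.
by move=> gU nUx; apply/eqP/negPn/negP => gx; apply: nUx; exact: gU.
Qed.

Lemma supp_stable g U x : supp g `<=` U -> U x -> U (g x).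
Proof.
move=> gU Ux; apply: contrapT => nUgx.
by apply: (nUgx); have /homeo_inj -> := supp_fix gU nUgx.
Qed.

Lemma supp_homeoV g U : supp g `<=` U -> supp g^-1 `<=` U.
Proof.
move=> gU x /eqP gx; apply: gU; apply/eqP => e; apply: gx.
by rewrite -{1}e homeoK.
Qed.

Lemma supp_homeoM g h U :
  supp g `<=` U -> supp h `<=` U -> supp (g * h) `<=` U.
Proof.
move=> gU hU x /eqP ghx; apply: contrapT => nUx; apply: ghx.
by rewrite homeoME (supp_fix hU) // (supp_fix gU).
Qed.

(** Images of sets under homeomorphisms are written as preimages under the
    inverse, so that membership computes. *)
Definition push h A : set X := homeo_inv h @^-1` A.

Lemma pushE h A x : push h A (h x) = A x.
Proof. by rewrite /push /= homeo_funK. Qed.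

Lemma push_homeoM g h A : push (g * h) A = push g (push h A).
Proof. by []. Qed.

Lemma push_clopen h A : clopen A -> clopen (push h A).
Proof. exact: (homeo_clopen h^-1). Qed.

Lemma pushS h A B : A `<=` B -> push h A `<=` push h B.
Proof. by move=> AB x; exact: AB. Qed.

Lemma supp_conj g h U :
  supp g `<=` U -> supp (h * g * h^-1) `<=` push h U.
Proof.
move=> gU x /eqP hx; apply: gU; apply/eqP => e; apply: hx.
by rewrite !homeoME e homeoVK.
Qed.

Lemma homeo_commutators_supp a b U : supp a `<=` U -> supp b `<=` U ->
  supp (a * b * a^-1 * b^-1) `<=` U.
Proof.
by move=> aU bU; do !apply: supp_homeoM => //; apply: supp_homeoV.
Qed.

End homeo_basics.

Section full_group_theory.
Context {X : topologicalType} (phi : homeo X).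
Implicit Types (g h : homeo X) (x y : X).

(** This form spares the arithmetic of signed exponents: transitivity of the
    orbit relation becomes an addition of natural numbers. *)
Lemma orbit_ofP x y :
  orbit_of phi x y <-> exists m n, (phi ^+ m) x = (phi ^+ n) y.
Proof.
split=> [[[k|k] _ <-]|[m [n e]]].
- by exists k, 0%N.
- by exists 0%N, k.+1; rewrite /= homeoVK.
- have [mn|nm] := leqP m n.
    case: (n - m)%N (subnK mn) => [|d] dE.
      by exists (Posz 0) => //; move: e; rewrite -dE => /homeo_inj.
    exists (Negz d) => //; apply: (@homeo_inj _ (phi ^+ n)); rewrite -e -dE /=.
    by rewrite addnC homeoXD homeoVK.
  exists (Posz (m - n)) => //; apply: (@homeo_inj _ (phi ^+ n)).
  by rewrite -e /= -homeoXD subnKC // ltnW.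
Qed.

Lemma orbit_of_sym x y : orbit_of phi x y -> orbit_of phi y x.
Proof. by move=> /orbit_ofP[m [n e]]; apply/orbit_ofP; exists n, m. Qed.

Lemma orbit_of_trans x y z :
  orbit_of phi x y -> orbit_of phi y z -> orbit_of phi x z.
Proof.
move=> /orbit_ofP[m [n e]] /orbit_ofP[p [q e']]; apply/orbit_ofP.
exists (p + m)%N, (n + q)%N.
by rewrite homeoXD e -homeoXD addnC homeoXD e' homeoXD.
Qed.

Lemma full_group1 : full_group phi 1.
Proof. by move=> x; exists 0%Z. Qed.

Lemma full_groupM g h :
  full_group phi g -> full_group phi h -> full_group phi (g * h).
Proof. by move=> Gg Gh x; exact: orbit_of_trans (Gh x) (Gg _). Qed.

Lemma full_groupV g : full_group phi g -> full_group phi g^-1.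
Proof.
by move=> Gg x; apply: orbit_of_sym; have := Gg (g^-1 x); rewrite homeoVK.
Qed.

Lemma full_groupX g n : full_group phi g -> full_group phi (g ^+ n).
Proof.
move=> Gg; elim: n => [|n IH]; first exact: full_group1.
by rewrite expgS; exact: full_groupM.
Qed.

Lemma full_groupJ g h :
  full_group phi g -> full_group phi h -> full_group phi (h * g * h^-1).
Proof.
by move=> Gg Gh; do 2?apply: full_groupM => //; exact: full_groupV.
Qed.

Lemma full_group_piecewise g :
  (forall x, exists2 h, full_group phi h & g x = h x) -> full_group phi g.
Proof. by move=> H x; have [h Gh ->] := H x; exact: Gh. Qed.

Lemma commutatorsJ c h : full_group phi h ->
  commutators (full_group phi) c -> commutators (full_group phi) (h * c * h^-1).
Proof.
move=> Gh [a Ga [b Gb <-]].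
exists (h * a * h^-1); first exact: full_groupJ.
exists (h * b * h^-1); first exact: full_groupJ.
by rewrite !invgM !invgK -!mulgA !mulKg.
Qed.

End full_group_theory.

Section swap.
Context {X : topologicalType} (h : homeo X) (A : set X).
Hypotheses (cA : clopen A) (hA : forall x, A x -> ~ A (h x)).

Let s x := if pselect (A x) then h x
           else if pselect (A (h^-1 x)) then h^-1 x else x.

Let sK : cancel s s.
Proof.
move=> x; rewrite /s; case: (pselect (A x)) => [Ax|nAx] /=.
  case: pselect => [Ahx|/= _]; first by have := hA Ax Ahx.
  by rewrite homeo_funK; case: pselect.
case: (pselect (A (h^-1 x))) => [Ax|nAx'] /=; case: pselect => //=.
  by rewrite homeo_invK.
by case: pselect.
Qed.

Let s_continuous : continuous s.
Proof.
have [oA clA] := cA; have [oB clB] := push_clopen h cA.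
move=> x; case: (pselect (A x)) => [Ax|nAx].
  apply: (@near_homeo_continuous _ _ h).
  have : nbhs x A by apply: open_nbhs_nbhs.
  by apply: filterS => y Ay; rewrite /s; case: pselect.
have nbA : nbhs x (~` A).
  by apply: open_nbhs_nbhs; split=> //; exact: closed_openC.
case: (pselect (push h A x)) => [Bx|nBx].
  apply: (@near_homeo_continuous _ _ h^-1).
  have nbB : nbhs x (push h A) by apply: open_nbhs_nbhs.
  apply: filterS2 nbA nbB => y nAy By; rewrite /s; case: pselect => //= _.
  by case: pselect.
apply: (@near_homeo_continuous _ _ 1).
have nbB : nbhs x (~` push h A).
  by apply: open_nbhs_nbhs; split=> //; exact: closed_openC.
apply: filterS2 nbA nbB => y nAy nBy; rewrite /s; case: pselect => //= _.
by case: pselect.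
Qed.

(** The involution exchanging [A] with its image under [h]: it moves [A] as
    [h] does but leaves the rest of the space alone. *)
Definition swap : homeo X := Homeo s_continuous s_continuous sK sK.

Lemma swapE x : A x -> swap x = h x.
Proof. by move=> Ax; rewrite /= /s; case: pselect. Qed.

Lemma swapVE x : A x -> swap (h x) = x.
Proof. by move=> Ax; have := sK x; rewrite -(swapE Ax). Qed.

Lemma swapK : swap^-1 = swap.
Proof. exact: homeo_ext. Qed.

Lemma supp_swap : supp swap `<=` A `|` push h A.
Proof.
move=> x /eqP; rewrite /= /s; case: pselect => /= [|_]; first by left.
by case: pselect => //=; right.
Qed.

(** On homeomorphisms supported in [A] conjugation by [h] can be replaced by
    conjugation by the exchange, and exchanges of disjoint pairs of sets can
    be glued together whereas the maps [h] cannot. *)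
Lemma swap_conj g : supp g `<=` A -> swap * g * swap^-1 = h * g * h^-1.
Proof.
move=> gA; rewrite swapK; apply: homeo_ext => x; rewrite !homeoME.
case: (pselect (push h A x)) => [Ax|nAx].
  rewrite -{1}(homeoVK h x) swapVE //; apply: swapE.
  exact: supp_stable.
rewrite (supp_fix gA nAx) homeoVK (supp_fix gA); first exact: sK.
case: (pselect (A x)) => [Ax|nAx']; first by rewrite swapE //; exact: hA.
by rewrite (supp_fix supp_swap) // => -[].
Qed.

Lemma full_group_swap phi : full_group phi h -> full_group phi swap.
Proof.
move=> Gh; apply: full_group_piecewise => x; rewrite /= /s.
case: pselect => /= _; first by exists h.
case: pselect => /= _; first by exists h^-1 => //; exact: full_groupV.
by exists 1 => //; exact: full_group1.
Qed.

End swap.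

(** * Products of homeomorphisms with disjoint supports *)

Section gluing.
Context {X : topologicalType}.
Implicit Types (g h : nat -> homeo X) (G H : homeo X) (W V : nat -> set X).

Definition disjoint_family W := forall m n x, W m x -> W n x -> m = n.

Definition supported g W := forall n, supp (g n) `<=` W n.

(** Characterising the product by its values, rather than defining it, makes
    the group laws below immediate and avoids any choice of an index. *)
Definition glues W g G :=
  (forall n x, W n x -> G x = g n x) /\
  (forall x, (forall n, ~ W n x) -> G x = x).

(** Disjoint clopen sets shrinking to the point [y]: the only place where
    infinitely many of them accumulate. *)
Definition null_family (y : X) W := [/\ forall n, clopen (W n),
  disjoint_family W, forall n, ~ W n y &
  forall O, nbhs y O -> exists M, forall n, (M <= n)%N -> W n `<=` O].

Lemma glues_uniq W g G H : glues W g G -> glues W g H -> G = H.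
Proof.
move=> [GW G0] [HW H0]; apply: homeo_ext => x.
have [[n Wn]|nW] := pselect (exists n, W n x); first by rewrite (GW n) ?(HW n).
by rewrite G0 ?H0 // => n Wn; apply: nW; exists n.
Qed.

Lemma glues_ext W g h G : (forall n, g n = h n) -> glues W g G -> glues W h G.
Proof. by move=> gh [GW G0]; split=> // n x Wn; rewrite -gh (GW n). Qed.

Lemma gluesM W g h G H : supported h W -> glues W g G -> glues W h H ->
  glues W (fun n => g n * h n) (G * H).
Proof.
move=> hW [GW G0] [HW H0]; split=> [n x Wn|x nW]; rewrite !homeoME.
  by rewrite (HW n) // (GW n) //; exact: (supp_stable (hW n)).
by rewrite H0 // G0.
Qed.

Lemma gluesV W g G : supported g W -> glues W g G ->
  glues W (fun n => (g n)^-1) G^-1.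
Proof.
move=> gW [GW G0]; split=> [n x Wn|x nW]; apply: (@homeo_inj _ G).
  rewrite homeoVK (GW n) ?homeoVK //.
  exact: (supp_stable (supp_homeoV (gW n))).
by rewrite homeoVK G0.
Qed.

Lemma supportedV W g : supported g W -> supported (fun n => (g n)^-1) W.
Proof. by move=> gW n; exact: supp_homeoV. Qed.

Lemma gluesJ W g h G H : supported g W -> supported h W ->
  glues W g G -> glues W h H ->
  glues W (fun n => h n * g n * (h n)^-1) (H * G * H^-1).
Proof.
move=> gW hW GG HH; apply: gluesM; first exact: supportedV.
  exact: gluesM.
exact: gluesV.
Qed.

Lemma glues_commutator W g h G H : supported g W -> supported h W ->
  glues W g G -> glues W h H ->
  glues W (fun n => g n * h n * (g n)^-1 * (h n)^-1) (G * H * G^-1 * H^-1).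
Proof.
move=> gW hW GG HH; apply: gluesM; first exact: supportedV.
  exact: gluesJ.
exact: gluesV.
Qed.

(** What is glued depends only on the homeomorphisms, not on the sets that
    separate their supports. *)
Lemma glues_widen W V g G : (forall n, W n `<=` V n) -> disjoint_family V ->
  supported g W -> glues W g G -> glues V g G.
Proof.
move=> WV dV gW [GW G0]; split=> [n x Vn|x nV]; last first.
  by apply: G0 => n /WV; exact: nV.
have [Wn|nW] := pselect (W n x); first exact: GW.
rewrite (supp_fix (gW n) nW); apply: G0 => m Wm; apply: nW.
by rewrite (dV n m x) //; exact: WV.
Qed.

Lemma glues_narrow W V g G : (forall n, W n `<=` V n) ->
  supported g W -> glues V g G -> glues W g G.
Proof.
move=> WV gW [GV G0]; split=> [n x Wn|x nW]; first by apply: GV; exact: WV.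
have [[n Vn]|nV] := pselect (exists n, V n x); last first.
  by apply: G0 => n Vn; apply: nV; exists n.
by rewrite (GV n) // (supp_fix (gW n)).
Qed.

Lemma full_group_glues phi W g G : (forall n, full_group phi (g n)) ->
  glues W g G -> full_group phi G.
Proof.
move=> Gg [GW G0]; apply: full_group_piecewise => x.
have [[n Wn]|nW] := pselect (exists n, W n x).
  by exists (g n) => //; exact: GW.
exists 1; first exact: full_group1.
by apply: G0 => n Wn; apply: nW; exists n.
Qed.

Section existence.
Variables (y : X) (W : nat -> set X).
Hypotheses (hX : hausdorff_space X) (nfW : null_family y W).

Let u g x := if pselect (exists n, W n x) is left e then g (projT1 (cid e)) x
             else x.

Let uW g n x : W n x -> u g x = g n x.
Proof.
have [_ dW _ _] := nfW.
move=> Wn; rewrite /u; case: pselect => [e|]; last by case; exists n.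
by case: cid => m /= Wm; rewrite (dW _ _ _ Wn Wm).
Qed.

Let u0 g x : (forall n, ~ W n x) -> u g x = x.
Proof. by move=> nW; rewrite /u; case: pselect => // e; have [n /nW] := e. Qed.

Let u_cont g : supported g W -> continuous (u g).
Proof.
move=> gW x; have [cW dW ny shr] := nfW.
have [[n Wn]|nW] := pselect (exists n, W n x).
  apply: (@near_homeo_continuous _ _ (g n)).
  have : nbhs x (W n) by apply: open_nbhs_nbhs; split=> //; case: (cW n).
  by apply: filterS => z Wz; rewrite (uW _ Wz).
have {}nW n : ~ W n x by move=> Wn; apply: nW; exists n.
move=> O; rewrite u0 // => xO.
(* near [x] only the sets [W n] with [n >= M] occur, and they stay in [O]
   or away from [x] *)
have [M [P xP PO]] : exists M, exists2 P, nbhs x P &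
    forall n, (M <= n)%N -> forall z, P z -> W n z -> O (u g z).
  have [xy|/eqP xy] := pselect (x = y).
    subst y; have [M MO] := shr O xO; exists M, setT; first exact: filterT.
    move=> n Mn z _ Wz; apply: (MO n Mn); rewrite (uW _ Wz).
    exact: (supp_stable (gW n)).
  move: hX; rewrite open_hausdorff => /(_ _ _ xy)[[P Q]] /=.
  rewrite !inE => -[xP yQ] [oP oQ PQ0].
  have PQ : P `&` Q `<=` set0 by rewrite PQ0.
  have [M MQ] := shr Q (open_nbhs_nbhs (conj oQ yQ)).
  exists M, P; first by apply: open_nbhs_nbhs.
  by move=> n Mn z Pz Wz; have := PQ z (conj Pz (MQ n Mn z Wz)).
have nM : nbhs x [set z | forall n, (n < M)%N -> ~ W n z].
  elim: M {PO} => [|M IH]; first by apply: filterE.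
  have : nbhs x (~` W M).
    apply: open_nbhs_nbhs; split; last exact: nW.
    by apply: closed_openC; case: (cW M).
  apply: filterS2 IH => z zM nz n; rewrite ltnS leq_eqVlt => /orP[/eqP->//|].
  exact: zM.
apply: filterS3 xO xP nM => z Oz Pz nz.
have [[n Wn]|nWz] := pselect (exists n, W n z); last first.
  by rewrite /= u0 // => n Wn; apply: nWz; exists n.
apply: (PO n) => //; rewrite leqNgt; apply/negP => /nz; exact.
Qed.

Let uK g : supported g W -> cancel (u g) (u (fun n => (g n)^-1)).
Proof.
move=> gW x; have [[n Wn]|nW] := pselect (exists n, W n x).
  rewrite (uW _ Wn) (uW _ (supp_stable (gW n) Wn)); exact: homeoK.
by rewrite !u0 // => n Wn; apply: nW; exists n.
Qed.

(** The shrinking of the sets is used for continuity at [y]: near [y] the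
    product moves points inside small sets. *)
Lemma glue_exists g : supported g W -> exists G, glues W g G.
Proof.
move=> gW; have gVW := supportedV gW.
have uVK : cancel (u (fun n => (g n)^-1)) (u g).
  have := uK gVW; congr (cancel _ (u _)); apply/funext => n; exact: invgK.
exists (Homeo (u_cont gW) (u_cont gVW) (uK gW) uVK).
by split=> [n x /uW|x /u0]; exact.
Qed.

End existence.

End gluing.

(** * Columns of first returns *)

Section level_permutations.
Local Open Scope nat_scope.

(** A column of height [h] is cycled along an odd number of levels: all of
    them if [h] is odd, all but the bottom one, which stays fixed, if [h] is
    even.  So the moved levels are [bot h], ..., [h.-1], and there are
    [(half_turn h).*2.+1] of them. *)
Definition bot (h : nat) : nat := ~~ odd h.

Definition half_turn (h : nat) : nat := h.-1./2.

Definition cyc h i :=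
  if i < bot h then i else if i.+1 == h then bot h else i.+1.

Definition cycV h i :=
  if i < bot h then i else if i == bot h then h.-1 else i.-1.

(** Rotation by [(half_turn h).+1] levels: on an odd cycle this is a square
    root of [cyc h]. *)
Definition turn h i :=
  if i < bot h then i
  else if i < bot h + half_turn h then i + (half_turn h).+1
  else i - half_turn h.

Definition turnV h i :=
  if i < bot h then i
  else if i <= bot h + half_turn h then i + half_turn h
  else i - (half_turn h).+1.

(** The reflection of the moved cycle that fixes its level [bot h]. *)
Definition flip h i := if i <= bot h then i else h + bot h - i.

Lemma levels_eq h : 0 < h -> h = (half_turn h).*2 + (bot h).+1 /\ bot h <= 1.
Proof. rewrite /half_turn /bot; lia. Qed.

Ltac level_lia :=
  let h := fresh in let i := fresh in let ih := fresh in
  intros h i ih; rewrite /cyc /cycV /turn /turnV /flip;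
  have [|] := @levels_eq h; [lia|];
  move: (half_turn h) (bot h); intros ? ?; rewrite -addnn;
  intros; repeat match goal with |- context [if ?b then _ else _] =>
    lazymatch b with context [if _ then _ else _] => fail
    | _ => case: (boolP b); intro end end; lia.

Definition bij_levels (p q : nat -> nat -> nat) :=
  forall h i, i < h -> p h i < h /\ q h (p h i) = i.

Lemma cycK : bij_levels cyc cycV. Proof. level_lia. Qed.
Lemma cycVK : bij_levels cycV cyc. Proof. level_lia. Qed.
Lemma turnK : bij_levels turn turnV. Proof. level_lia. Qed.
Lemma turnVK : bij_levels turnV turn. Proof. level_lia. Qed.
Lemma flipK : bij_levels flip flip. Proof. level_lia. Qed.

(** A reflection inverts every rotation, so this commutator is the square of
    [turn]. *)
Lemma cyc_commutator h i : i < h ->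
  cyc h i = turn h (flip h (turnV h (flip h i))).
Proof. move: h i; level_lia. Qed.

End level_permutations.

Section towers.
Context {X : topologicalType} (g : homeo X) (V : set X).
Hypothesis cV : clopen V.
Implicit Types (x y : X) (h i : nat) (p q : nat -> nat -> nat) (T : homeo X).

Definition first_return y h := [/\ V y, (0 < h)%N, V ((g ^+ h) y) &
  forall j, (0 < j < h)%N -> ~ V ((g ^+ j) y)].

Definition on_level x y h i :=
  [/\ first_return y h, (i < h)%N & x = (g ^+ i) y].

Lemma first_return_uniq y h k : first_return y h -> first_return y k -> h = k.
Proof.
wlog hk : h k / (h <= k)%N.
  move=> H; have [hk|/ltnW kh] := leqP h k; first exact: H.
  by move=> rh rk; rewrite (H k h).
move=> [_ h0 Vh _] [_ _ _ nV]; apply/eqP; rewrite eqn_leq hk leqNgt /=.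
by apply/negP => lt; apply: nV Vh; rewrite h0.
Qed.

Lemma on_level_uniq x y h i y' h' i' : on_level x y h i ->
  on_level x y' h' i' -> [/\ y = y', h = h' & i = i'].
Proof.
wlog ii : y h i y' h' i' / (i <= i')%N.
  move=> H; have [ii|/ltnW ii] := leqP i i'; first exact: H.
  by move=> l1 l2; have [-> -> ->] := H _ _ _ _ _ _ ii l2 l1.
move=> [ry ih xE] [ry' ih' xE']; have {xE' xE}e : y = (g ^+ (i' - i)) y'.
  by apply: (@homeo_inj _ (g ^+ i)); rewrite -homeoXD subnKC // -xE -xE'.
have i0 : (i' - i = 0)%N.
  apply/eqP; rewrite -leqn0 leqNgt; apply/negP => ii0.
  have [Vy _ _ _] := ry; case: ry' => _ _ _ /(_ (i' - i)%N); rewrite -e.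
  by apply => //; lia.
move: e; rewrite i0 /= => e; subst y'.
by rewrite (first_return_uniq ry ry'); split=> //; lia.
Qed.

Lemma near_first_return y h : first_return y h ->
  \forall z \near y, first_return z h.
Proof.
move=> [Vy h0 Vh nV]; have [oV clV] := cV.
have nJ : \forall z \near y, forall j, (0 < j < h)%N -> ~ V ((g ^+ j) z).
  elim: h {h0 Vh} nV => [|h IH] nV.
    by apply: filterE => z j; rewrite ltn0 andbF.
  have {}IH := IH (fun j jh => nV j ltac:(lia)).
  have : \forall z \near y, (0 < h)%N -> ~ V ((g ^+ h) z).
    have [->|h0] := posnP h; first by apply: filterE.
    have : nbhs ((g ^+ h) y) (~` V).
      apply: open_nbhs_nbhs; split; first exact: closed_openC.
      by apply: nV; rewrite h0 leqnn.
    by move=> /homeo_nbhs; apply: filterS.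
  apply: filterS2 IH => z zj zh j /andP[j0].
  rewrite ltnS leq_eqVlt => /orP[/eqP jh|jh].
    by rewrite jh in j0 *; apply: zh.
  by apply: zj; rewrite j0.
have yV : nbhs y V by apply: open_nbhs_nbhs.
have yVh : nbhs y ((g ^+ h) @^-1` V).
  by apply: homeo_nbhs; apply: open_nbhs_nbhs.
by apply: filterS3 nJ yV yVh => z ? ? ?; split.
Qed.

Lemma near_on_level x y h i : on_level x y h i ->
  \forall z \near x, on_level z (((g ^+ i)^-1) z) h i.
Proof.
move=> [ry ih ->]; have := near_first_return ry.
rewrite -{1}(homeoK (g ^+ i) y) => /homeo_nbhs; apply: filterS => z rz.
by split=> //; rewrite homeoVK.
Qed.

Lemma first_return_exists y k : V y -> V ((g ^+ k.+1) y) ->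
  exists h, first_return y h.
Proof.
move=> Vy Vk.
have ex : exists n, `[< V ((g ^+ n.+1) y) >] by exists k; exact/asboolP.
case: (ex_minnP ex) => n /asboolP Vn nmin; exists n.+1; split=> // -[//|j] jn Vj.
by have := nmin j; rewrite asboolT // => /(_ isT); lia.
Qed.

(** The level of [x] is the time elapsed since its last visit to [V]: had it
    reached the height of the column, there would be a later visit. *)
Lemma on_level_exists x w k : V w -> (g ^+ k) w = x ->
  (forall y, V y -> exists l, V ((g ^+ l.+1) y)) ->
  exists y h i, on_level x y h i.
Proof.
move=> Vw kE rec.
have ex : exists n, `[< exists2 y, V y & (g ^+ n) y = x >].
  by exists k; apply/asboolP; exists w.
case: (ex_minnP ex) => i /asboolP[y Vy yE] imin.
have [m Vm] := rec y Vy; have [h rh] := first_return_exists Vy Vm.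
exists y, h, i; split=> //; rewrite ltnNge; apply/negP => hi.
have [_ h0 Vh _] := rh; have := imin (i - h)%N; rewrite asboolT; last first.
  by exists ((g ^+ h) y) => //; rewrite -homeoXD subnK.
by move=> /(_ isT); lia.
Qed.

Definition permutes_levels p T :=
  (forall x y h i, on_level x y h i -> T x = (g ^+ p h i) y) /\
  (forall x, (forall y h i, ~ on_level x y h i) -> T x = x).

Lemma on_levelP x : (exists y h i, on_level x y h i) \/
  (forall y h i, ~ on_level x y h i).
Proof.
have [|n] := pselect (exists y h i, on_level x y h i); first by left.
by right=> y h i xl; apply: n; exists y, h, i.
Qed.

Lemma on_level_move x y h i j :
  on_level x y h i -> (j < h)%N -> on_level ((g ^+ j) y) y h j.
Proof. by move=> [ry _ _] jh; split. Qed.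

Lemma permutes_levels_uniq p q T S : (forall h i, (i < h)%N -> p h i = q h i) ->
  permutes_levels p T -> permutes_levels q S -> T = S.
Proof.
move=> pq [TV T0] [SV S0]; apply: homeo_ext => x.
have [[y [h [i xl]]]|nl] := on_levelP x; last by rewrite T0 ?S0.
by rewrite (TV _ _ _ _ xl) (SV _ _ _ _ xl) pq //; case: xl.
Qed.

Lemma permutes_levelsM p q T S : (forall h i, (i < h)%N -> (q h i < h)%N) ->
  permutes_levels p T -> permutes_levels q S ->
  permutes_levels (fun h i => p h (q h i)) (T * S).
Proof.
move=> qh [TV T0] [SV S0]; split=> [x y h i xl|x nl]; rewrite homeoME.
  rewrite (SV _ _ _ _ xl); apply: TV; apply: on_level_move (xl) _.
  by apply: qh; case: xl.
by rewrite S0 ?T0.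
Qed.

Lemma permutes_levelsV p q T : bij_levels p q -> bij_levels q p ->
  permutes_levels p T -> permutes_levels q T^-1.
Proof.
move=> pK qK [TV T0]; split=> [x y h i xl|x nl]; apply: (@homeo_inj _ T).
  have [_ ih xE] := xl; have [qh pq] := qK h i ih.
  by rewrite homeoVK (TV _ _ _ _ (on_level_move xl qh)) pq.
by rewrite homeoVK T0.
Qed.

Let u p x := if pselect (exists t, on_level x t.1.1 t.1.2 t.2) is left e
  then let t := projT1 (cid e) in (g ^+ p t.1.2 t.2) t.1.1 else x.

Let uE p x y h i : on_level x y h i -> u p x = (g ^+ p h i) y.
Proof.
move=> xl; rewrite /u; case: pselect => [e|]; last by case; exists ((y, h), i).
by case: cid => -[[y' h'] i'] /= /(on_level_uniq xl)[-> -> ->].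
Qed.

Let u0 p x : (forall y h i, ~ on_level x y h i) -> u p x = x.
Proof. by move=> nl; rewrite /u; case: pselect => // e; have [t /nl] := e. Qed.

Let uK p q : bij_levels p q -> cancel (u p) (u q).
Proof.
move=> pq x; have [[y [h [i xl]]]|nl] := on_levelP x; last by rewrite !u0.
have [_ ih xE] := xl; have [ph qp] := pq h i ih.
by rewrite (uE _ xl) (uE _ (on_level_move xl ph)) qp.
Qed.

Variable U : set X.
Hypotheses (clU : closed U).
Hypothesis levelU : forall x, U x <-> exists y h i, on_level x y h i.

Let u_continuous p : continuous (u p).
Proof.
move=> x; have [[y [h [i xl]]]|nl] := on_levelP x.
  apply: (@near_homeo_continuous _ _ (g ^+ p h i * (g ^+ i)^-1)).
  by apply: filterS (near_on_level xl) => z zl; rewrite (uE _ zl).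
apply: (@near_homeo_continuous _ _ 1).
have : nbhs x (~` U).
  apply: open_nbhs_nbhs; split; first exact: closed_openC.
  by move=> /levelU[y [h [i]]]; exact: nl.
apply: filterS => z nUz; rewrite u0 // => y h i zl; apply: nUz.
by apply/levelU; exists y, h, i.
Qed.

(** On the columns the rearranged map is locally an iterate of [g], since
    first return times are locally constant; the complement of the columns is
    open because they fill the closed set [U]. *)
Lemma permutes_levels_exists p q : bij_levels p q -> bij_levels q p ->
  exists T, permutes_levels p T.
Proof.
move=> pq qp.
exists (Homeo (@u_continuous p) (@u_continuous q) (uK pq) (uK qp)).
by split=> [x y h i /(uE p)|x /(u0 p)]; exact.
Qed.

Lemma supp_permutes_levels p T : permutes_levels p T -> supp T `<=` U.
Proof.
move=> [_ T0] x /eqP Tx; apply: contrapT => nU; apply: Tx; apply: T0 => y h i xl.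
by apply: nU; apply/levelU; exists y, h, i.
Qed.

End towers.

Lemma full_group_permutes_levels (X : topologicalType) (phi g T : homeo X) V p :
  full_group phi g -> permutes_levels g V p T -> full_group phi T.
Proof.
move=> Gg [TV T0]; apply: full_group_piecewise => x.
have [[y [h [i xl]]]|nl] := on_levelP g V x; last first.
  by exists 1; [exact: full_group1|exact: T0].
exists (g ^+ p h i * (g ^+ i)^-1).
  by apply: full_groupM; [|apply: full_groupV]; exact: full_groupX.
by rewrite (TV _ _ _ _ xl) homeoME; case: xl => _ _ ->; rewrite homeoK.
Qed.

(** * Splitting a commutator off a recurrent homeomorphism *)

Section induction.
Context {X : topologicalType}.
Implicit Types (f g : homeo X) (U V W : set X) (x y : X).

(** The form of minimality that passes to first return maps: every point of
    [U] visits every neighbourhood of [x0], both in the future and in the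
    past. *)
Definition recurs g U x0 := forall x, U x -> forall V, nbhs x0 V ->
  (exists k, V ((g ^+ k.+1) x)) /\
  (exists k, exists2 w, V w & (g ^+ k.+1) w = x).

(** If [f] is the first return map of [g] to [W], then the [f]-orbit of a
    point of [W] follows all visits of its [g]-orbit to [W]. *)
Lemma recurs_first_returns g f U W x0 : nbhs x0 W -> W `<=` U ->
  recurs g U x0 ->
  (forall x, W x -> exists r, [/\ f x = (g ^+ r.+1) x, W (f x) &
     forall j, (0 < j < r.+1)%N -> ~ W ((g ^+ j) x)]) ->
  recurs f W x0.
Proof.
move=> xW WU rec fr.
have follow k : forall x, W x -> W ((g ^+ k.+1) x) ->
    exists m, (f ^+ m.+1) x = (g ^+ k.+1) x.
  elim/ltn_ind: k => k IH x Wx Wk; have [r [fE Wfx nW]] := fr x Wx.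
  have [rk|kr] := leqP r k; last by have /nW : (0 < k.+1 < r.+1)%N by lia.
  move: rk; rewrite leq_eqVlt => /orP[/eqP <-|rk].
    by exists 0%N; rewrite expg1.
  have kE : (k.+1 = (k - r).-1.+1 + r.+1)%N by lia.
  have [||| m mE] := IH (k - r).-1 _ (f x) => //; first by lia.
    by rewrite fE -homeoXD -kE.
  by exists m.+1; rewrite homeoXSr mE fE -homeoXD -kE.
move=> x Wx V xV; have xVW : nbhs x0 (V `&` W) by exact: filterI.
have [[k [Vk Wk]] [l [w [Vw Ww] wE]]] := rec x (WU x Wx) _ xVW; split.
  by have [m mE] := follow k x Wx Wk; exists m; rewrite mE.
have [|m mE] := follow l w Ww; first by rewrite wE.
by exists m, w => //; rewrite mE.
Qed.

(** Removing from [g] its motion inside the columns over [V] leaves a first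
    return map.  A full column cycle would leave the return map to [V], but a
    cycle of even length is an odd permutation; since the columns of even
    height are cycled only above their bottom level, what remains of [g] is
    its return map to [V] together with the levels number 1 of these columns,
    and all cycles that are split off are commutators. *)
Lemma split_commutator phi g U V x0 :
  full_group phi g -> clopen U -> supp g `<=` U -> recurs g U x0 ->
  clopen V -> V x0 -> V `<=` U ->
  exists g' d b A, [/\ full_group phi g', full_group phi d & full_group phi b] /\
    [/\ g = g' * (d * b * d^-1 * b^-1), supp d `<=` U, supp b `<=` U,
        supp g' `<=` V `|` push g A & recurs g' (V `|` push g A) x0] /\
    [/\ clopen A, A `<=` V & forall y, A y -> ~ V (g y)].
Proof.
move=> Gg [oU clU] gU rec cV Vx0 VU; have [oV clV] := cV.
have xV : nbhs x0 V by apply: open_nbhs_nbhs.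
have frV y : V y -> exists h, first_return g V y h.
  move=> Vy; have [[k Vk] _] := rec y (VU y Vy) V xV.
  exact: first_return_exists Vk.
have gXU n y : U y -> U ((g ^+ n) y).
  by move=> Uy; elim: n => // n IH; rewrite homeoXS; exact: supp_stable.
have levelU x : U x <-> exists y h i, on_level g V x y h i.
  split=> [Ux|[y [h [i [[Vy _ _ _] _ ->]]]]]; last by apply/gXU/VU.
  have [_ [k [w Vw wE]]] := rec x Ux V xV.
  apply: on_level_exists wE _ => // y Vy.
  by have [] := rec y (VU y Vy) V xV.
have [d dP] := permutes_levels_exists cV clU levelU turnK turnVK.
have [b bP] := permutes_levels_exists cV clU levelU flipK flipK.
have [c cP] := permutes_levels_exists cV clU levelU cycK cycVK.
have dU := supp_permutes_levels levelU dP.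
have bU := supp_permutes_levels levelU bP.
have cE : c = d * b * d^-1 * b^-1.
  apply: (permutes_levels_uniq _ cP); first exact: cyc_commutator.
  have lt p q (pq : bij_levels p q) h i : (i < h)%N -> (p h i < h)%N.
    by move=> /pq[].
  have dbP := permutes_levelsM (lt _ _ flipK) dP bP.
  have dbdP := permutes_levelsM (lt _ _ turnVK) dbP
    (permutes_levelsV turnK turnVK dP).
  exact: permutes_levelsM (lt _ _ flipK) dbdP (permutes_levelsV flipK flipK bP).
have [cVP cV0] := permutes_levelsV cycK cycVK cP.
pose A := [set y | exists2 h, first_return g V y h & ~~ odd h].
have AV : A `<=` V by move=> y [h [Vy _ _ _] _].
have gA y : A y -> ~ V (g y).
  move=> [h [_ h0 _ nV] hev]; rewrite -[g]expg1; apply: nV.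
  by case: h h0 hev => [|[|h]].
have cA : clopen A.
  split.
    rewrite openE => y [h yh hev].
    by apply: filterS (near_first_return cV yh) => z zh; exists h.
  rewrite -[A]setCK; apply: open_closedC; rewrite openE => y nAy.
  have [Vy|nVy] := pselect (V y); last first.
    apply: (@filterS _ _ _ (~` V)); first by move=> z nVz /AV.
    by apply: open_nbhs_nbhs; split=> //; exact: closed_openC.
  have [h yh] := frV y Vy.
  apply: filterS (near_first_return cV yh) => z zh [k zk kev].
  by apply: nAy; exists h => //; rewrite (first_return_uniq zh zk).
pose g' := g * c^-1; pose W := V `|` push g A.
have Gc : full_group phi c by exact: full_group_permutes_levels cP.
have g'E x y h i : on_level g V x y h i -> g' x = (g ^+ (cycV h i).+1) y.
  by move=> xl; rewrite homeoME (cVP _ _ _ _ xl) -homeoXS.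
have g'W : supp g' `<=` W.
  move=> x /eqP g'x; apply: contrapT => nWx; apply: g'x.
  have [[y [h [i xl]]]|nl] := on_levelP g V x; last first.
    rewrite homeoME cV0 // (supp_fix gU) // => /levelU[y [h [i]]]; exact: nl.
  rewrite (g'E _ _ _ _ xl); have [yh ih ->] := xl.
  suff bi : (bot h < i)%N.
    by congr ((g ^+ _) y); rewrite /cycV; do 2?case: ifP; lia.
  rewrite ltnNge; apply/negP => bi; apply: nWx; have [_ _ xE] := xl.
  case: i xE ih bi {xl} => [|[|i]] xE ih bi.
  - by left; rewrite xE; case: yh.
  - right; rewrite xE expg1 pushE; exists h => //.
    by move: bi; rewrite /bot; case: odd.
  - by move: bi; rewrite /bot; case: odd.
exists g', d, b, A; split; first split.
- by apply: full_groupM => //; exact: full_groupV.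
- exact: full_group_permutes_levels dP.
- exact: full_group_permutes_levels bP.
split=> //; split=> //; first by rewrite -cE /g' mulgVK.
apply: recurs_first_returns rec _ => //.
- by apply: filterS xV => z; left.
- move=> x [/VU//|Ax]; rewrite -(homeoVK g x); apply: (supp_stable gU).
  exact/VU/AV.
move=> x Wx; suff [r g'x nW] : exists2 r, g' x = (g ^+ r.+1) x &
    forall j, (0 < j < r.+1)%N -> ~ W ((g ^+ j) x).
  by exists r; split=> //; exact: (supp_stable g'W).
(* inside a column the set [W] is met at the bottom level and, if the height
   is even, at level 1 *)
have notW y h j : first_return g V y h -> (0 < j < h)%N ->
    (j = 1%N -> odd h) -> ~ W ((g ^+ j) y).
  move=> yh /andP[j0 jh] j1 [|]; first by case: yh => _ _ _; apply; rewrite j0.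
  case: j j0 jh j1 => // -[_ _ /(_ erefl) hodd|j _ jh _].
    rewrite expg1 pushE => -[k yk]; by rewrite -(first_return_uniq yh yk) hodd.
  rewrite homeoXS pushE => /AV; case: yh => _ _ _; apply; lia.
case: Wx => [Vx|Ax].
  have [h xh] := frV x Vx; have [_ h0 _ _] := xh.
  have xl : on_level g V x x h 0 by [].
  have [hodd|hev] := boolP (odd h).
    exists h.-1 => [|j jh]; last by apply: (notW x h) => //; lia.
    by rewrite (g'E _ _ _ _ xl) /cycV /bot hodd.
  exists 0%N => [|[|j]//].
  by rewrite (g'E _ _ _ _ xl) /cycV /bot hev.
set y := g^-1 x in Ax; have [h yh hev] := Ax.
have xE : x = (g ^+ 1) y by rewrite expg1 homeoVK.
have h1 : (1 < h)%N by case: yh => _; case: h hev => [|[|h]].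
have xl : on_level g V x y h 1 by [].
exists h.-2 => [|j jh].
  rewrite (g'E _ _ _ _ xl) /cycV /bot hev /= xE -homeoXD; congr ((g ^+ _) y); lia.
rewrite xE -homeoXD; apply: (notW y h) => //; lia.
Qed.

End induction.

(** * The infinite swindle *)

Section null_families.
Context {X : topologicalType} (y : X).
Implicit Types W V : nat -> set X.

Lemma null_family_sub V W : null_family y W -> (forall n, clopen (V n)) ->
  (forall n, V n `<=` W n) -> null_family y V.
Proof.
move=> [_ dW ny shr] cV VW; split=> //.
- by move=> m n x Vm Vn; apply: (dW m n x); exact: VW.
- by move=> n /VW; exact: ny.
- by move=> O /shr[M MO]; exists M => n Mn x /VW; exact: MO.
Qed.

Lemma null_family_succ W : null_family y W -> null_family y (fun n => W n.+1).
Proof.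
move=> [cW dW ny shr]; split=> //.
- by move=> m n x Wm Wn; have [] := dW _ _ _ Wm Wn.
- by move=> O /shr[M MO]; exists M => n Mn; apply: MO; exact: leqW.
Qed.

(** Shifting one of two families by one index keeps the sets apart; this
    prepares the exchange of a set with its successor. *)
Lemma null_family_stagger V W : null_family y (fun n => V n `|` W n) ->
  (forall n, clopen (V n)) -> (forall n, clopen (W n)) ->
  (forall n x, V n x -> ~ W n x) -> null_family y (fun n => V n `|` W n.+1).
Proof.
move=> [_ dVW ny shr] cV cW VW; split.
- by move=> n; exact: clopenU.
- have aux m n x : V m x -> ~ W n x.
    move=> Vm Wn; have mn : m = n by apply: (dVW m n x); [left|right].
    by subst m; exact: VW Wn.
  move=> m n x [Vm|Wm] [Vn|Wn].
  + by apply: (dVW _ _ x); left.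
  + by have := aux _ _ _ Vm Wn.
  + by have := aux _ _ _ Vn Wm.
  + by suff [] : m.+1 = n.+1 by []; apply: (dVW _ _ x); right.
- by move=> n [Vy|Wy]; [apply: (ny n); left|apply: (ny n.+1); right].
- move=> O /shr[M MO]; exists M => n Mn x [Vx|Wx].
    by apply: (MO n) => //; left.
  by apply: (MO n.+1); [exact: leqW|right].
Qed.

End null_families.

Section swindle.
Context {X : topologicalType} (phi : homeo X) (y : X).
Variables (g d b a e : nat -> homeo X) (U : nat -> set X).

Let E n := push (a n) (U n).
Let Z n := push (e n) (U n).

Hypotheses (hX : hausdorff_space X).
Hypotheses (Gg : forall n, full_group phi (g n))
  (Gd : forall n, full_group phi (d n)) (Gb : forall n, full_group phi (b n))
  (Ga : forall n, full_group phi (a n)) (Ge : forall n, full_group phi (e n)).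
Hypotheses (cU : forall n, clopen (U n)) (UU : forall n, U n.+1 `<=` U n).
Hypotheses (gU : supported g U) (dU : supported d U) (bU : supported b U).
Hypothesis gE : forall n,
  g n = g n.+1 * (d n * b n * (d n)^-1 * (b n)^-1).
Hypotheses (nEZ : null_family y (fun n => E n `|` Z n))
  (EZ : forall n x, E n x -> ~ Z n x).

Let cE n : clopen (E n). Proof. exact: push_clopen. Qed.
Let cZ n : clopen (Z n). Proof. exact: push_clopen. Qed.

Let conj_trans (h k u : homeo X) :
  (h * k^-1) * (k * u * k^-1) * (h * k^-1)^-1 = h * u * h^-1.
Proof. by rewrite invgM invgK !mulgA !mulgVK. Qed.

Let push_trans (h k : homeo X) (B : set X) :
  push (h * k^-1) (push k B) = push h B.
Proof. by rewrite -push_homeoM mulgVK. Qed.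

(** Infinite swindle: place a copy of [g n] on [E n] for all [n] at once, and
    call [F] the product.  With [g n] replaced by [g n.+1] the product [F1]
    differs from [F] by a commutator.  On the other hand [F1] consists of
    copies of [g 1], [g 2], ..., just as [F] without its first factor, so that
    some [t] in the full group conjugates the one to the other.  Comparing
    both expressions isolates the first factor, a copy of [g 0].  The
    conjugator [t] is composed of two involutions: the first moves each copy
    from [E n] to [Z n.+1] and the second from [Z n.+1] to [E n.+1].  A direct
    exchange of all [E n] with [E n.+1] at once would be contradictory. *)
Lemma swindle : exists c1 c2, [/\ commutators (full_group phi) c1,
  commutators (full_group phi) c2 & g 0 = c1 * c2].
Proof.
pose cj (h : nat -> homeo X) (u : nat -> homeo X) n := h n * u n * (h n)^-1.
have G_cj h u : (forall n, full_group phi (h n)) ->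
    (forall n, full_group phi (u n)) -> forall n, full_group phi (cj h u n).
  by move=> Gh Gu n; exact: full_groupJ.
have nE : null_family y E.
  by apply: null_family_sub nEZ _ _ => // n x; left.
have nW1 := null_family_stagger nEZ cE cZ EZ.
have nW2 : null_family y (fun n => E n.+1 `|` Z n.+1).
  exact: null_family_succ nEZ.
set W1 := (fun n => E n `|` Z n.+1) in nW1.
set W2 := (fun n => E n.+1 `|` Z n.+1) in nW2.
pose E' n := push (a n) (U n.+1).
have E'E n : E' n `<=` E n by apply: pushS; exact: UU.
have dEZ m n x : E m x -> ~ Z n x.
  move=> Em Zn; have [_ dW _ _] := nEZ.
  have mn : m = n by apply: (dW m n x); [left|right].
  by subst m; exact: EZ Zn.
have s_cj (u : nat -> homeo X) : supported u U -> supported (cj a u) E.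
  by move=> uU n; apply: supp_conj; exact: uU.
pose g1 n := g n.+1.
have g1U : supported g1 U by move=> n x gx; apply: UU; exact: gU gx.
have [F FP] := glue_exists hX nE (s_cj _ gU).
have [F1 F1P] := glue_exists hX nE (s_cj _ g1U).
have [D DP] := glue_exists hX nE (s_cj _ dU).
have [B BP] := glue_exists hX nE (s_cj _ bU).
have GF1 : full_group phi F1.
  by apply: full_group_glues F1P; apply: G_cj => // n; exact: Gg.
have GD : full_group phi D by apply: full_group_glues DP; exact: G_cj.
have GB : full_group phi B by apply: full_group_glues BP; exact: G_cj.
have FE : F = F1 * (D * B * D^-1 * B^-1).
  apply: (glues_uniq FP); apply: glues_ext (gluesM _ F1P _); last first.
  - exact: (glues_commutator (s_cj _ dU) (s_cj _ bU) DP BP).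
  - move=> n; exact: homeo_commutators_supp (s_cj _ dU n) (s_cj _ bU n).
  - by move=> n; rewrite /cj /= /g1 [in RHS]gE !invgM !invgK -!mulgA !mulKg.
pose s1 n := e n.+1 * (a n)^-1.
have s1E n x : E' n x -> ~ E' n (s1 n x).
  move=> E'x /E'E Es; apply: (dEZ _ n.+1 _ Es).
  by rewrite /Z /s1 -(push_trans _ (a n)) pushE; exact: E'x.
pose S1 n := swap (push_clopen (a n) (cU n.+1)) (@s1E n).
have S1W : supported S1 W1.
  move=> n; apply: subset_trans (@supp_swap _ _ _ _ _) _.
  by rewrite push_trans; exact: setUSS (E'E n) (@subset_refl _ _).
have GS1 n : full_group phi (S1 n).
  by apply: full_group_swap; apply: full_groupM => //; exact: full_groupV.
have [S SP] := glue_exists hX nW1 S1W.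
have GS := full_group_glues GS1 SP.
pose s2 n := a n.+1 * (e n.+1)^-1.
have s2E n x : Z n.+1 x -> ~ Z n.+1 (s2 n x).
  move=> Zx; apply: (@dEZ n.+1).
  by rewrite /E /s2 -(push_trans _ (e n.+1)) pushE; exact: Zx.
pose S2 n := swap (cZ n.+1) (@s2E n).
have S2W : supported S2 W2.
  move=> n; apply: subset_trans (@supp_swap _ _ _ _ _) _.
  by rewrite push_trans setUC.
have GS2 n : full_group phi (S2 n).
  by apply: full_group_swap; apply: full_groupM => //; exact: full_groupV.
have [T TP] := glue_exists hX nW2 S2W.
have GT := full_group_glues GS2 TP.
have g1E' n : supp (cj a g1 n) `<=` E' n.
  by apply: supp_conj; exact: gU.
have EW1 n : E n `<=` W1 n by move=> x; left.
have [_ dW1 _ _] := nW1; have [_ dW2 _ _] := nW2.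
have F1P1 : glues W1 (cj a g1) F1.
  exact: (glues_widen EW1 dW1 (s_cj _ g1U) F1P).
have FSP1 : glues W1 (fun n => e n.+1 * g n.+1 * (e n.+1)^-1) (S * F1 * S^-1).
  apply: glues_ext (gluesJ _ S1W F1P1 SP) => n.
    by rewrite swap_conj ?conj_trans //; exact: g1E'.
  by apply: subset_trans (EW1 n); exact: s_cj.
have g1Z : supported (fun n => e n.+1 * g n.+1 * (e n.+1)^-1) (fun n => Z n.+1).
  by move=> n; apply: supp_conj; exact: gU.
have ZW2 n : Z n.+1 `<=` W2 n by move=> x; right.
have FSP2 : glues W2 (fun n => e n.+1 * g n.+1 * (e n.+1)^-1) (S * F1 * S^-1).
  apply: (glues_widen ZW2 dW2 g1Z).
  by apply: glues_narrow g1Z FSP1 => n x; right.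
have FTP : glues W2 (fun n => cj a g n.+1) (T * (S * F1 * S^-1) * T^-1).
  apply: glues_ext (gluesJ _ S2W FSP2 TP) => n.
    by rewrite swap_conj ?conj_trans.
  by apply: subset_trans (ZW2 n); exact: g1Z.
have {FTP} [FTE FT0] : glues (fun n => E n.+1) (fun n => cj a g n.+1)
    (T * (S * F1 * S^-1) * T^-1).
  by apply: glues_narrow FTP => n x; [left|exact: s_cj].
set t := T * S; have Gt : full_group phi t by exact: full_groupM.
have tE : T * (S * F1 * S^-1) * T^-1 = t * F1 * t^-1.
  by rewrite /t invgM !mulgA.
rewrite tE in FTE FT0; clearbody t; clear tE.
have FE0 : F = a 0 * g 0 * (a 0)^-1 * (t * F1 * t^-1).
  have [_ dE _ _] := nE; have [FW F0] := FP.
  apply: homeo_ext => x; rewrite [RHS]homeoME.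
  have fix0 z : ~ E 0 z -> (a 0 * g 0 * (a 0)^-1) z = z.
    exact: supp_fix (s_cj _ gU 0%N).
  have [[[|n] En]|nE'] := pselect (exists n, E n x).
  - by rewrite FT0 ?(FW 0%N) // => n /(dE _ _ _ En).
  - rewrite (FTE n) // (FW n.+1) // fix0 // => E0.
    by have := dE _ _ _ E0 (supp_stable (s_cj _ gU n.+1) En).
  - rewrite FT0 ?F0 ?fix0 // => [E0|n En|n En].
    + by apply: nE'; exists 0%N.
    + by apply: nE'; exists n.
    + by apply: nE'; exists n.+1.
have gE0 : a 0 * g 0 * (a 0)^-1 =
    (F1 * (D * B * D^-1 * B^-1) * F1^-1) * (F1 * t * F1^-1 * t^-1).
  apply: (mulIg (t * F1 * t^-1)); rewrite -FE0 FE.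
  by rewrite !mulgA !mulgVK mulgK.
have [Ga0 GaV] : full_group phi (a 0) /\ full_group phi (a 0)^-1.
  by split=> //; exact: full_groupV.
exists ((a 0)^-1 * (F1 * (D * B * D^-1 * B^-1) * F1^-1) * (a 0)^-1^-1).
exists ((a 0)^-1 * (F1 * t * F1^-1 * t^-1) * (a 0)^-1^-1); split.
- apply: commutatorsJ => //; apply: commutatorsJ => //.
  by exists D => //; exists B.
- by apply: commutatorsJ => //; exists F1 => //; exists t.
- rewrite invgK; apply: (mulgI (a 0)); apply: (mulIg (a 0)^-1); rewrite gE0.
  move: (F1 * _ * _) (F1 * t * _ * _) => P Q.
  by rewrite !mulgA mulgV mul1g !mulgK.
Qed.

End swindle.

(** * Copies shrinking to a point *)

Section cantor_like_spaces.
Context {X : topologicalType}.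
Hypothesis cantorX : cantor_like X.
Implicit Types (x y : X) (O P : set X).

Let hX : hausdorff_space X. Proof. by case: cantorX. Qed.

Lemma clopen_nbhs_base x O : nbhs x O ->
  exists P, [/\ clopen P, P x & P `<=` O].
Proof.
case: cantorX => _ cptX _ zX xO.
by have [P [Px cP] PO] := zero_dimensional_cvg hX zX cptX xO; exists P.
Qed.

Lemma open_remove x O : open O -> open (O `\ x).
Proof.
move=> oO; apply: openI => //; apply: closed_openC.
exact: accessible_closed_set1 (hausdorff_accessible hX) x.
Qed.

Lemma open_remove_nonempty x O : open O -> O !=set0 -> O `\ x !=set0.
Proof.
case: cantorX => /perfectTP_ex pX _ _ _ oO O0.
have [a [b [Oa Ob ab]]] := pX O oO O0.
have [ax|/eqP ax] := eqVneq a x; last by exists a.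
by exists b; split=> // bx; move: ab; rewrite ax bx eqxx.
Qed.

Section transport.
Variables (phi : homeo X) (Y : set X) (x0 : X).
Hypotheses (oY : open Y).
Hypothesis dense0 : forall O, open O -> O `&` Y !=set0 ->
  exists2 h, full_group phi h & O (h x0).

(** Several disjoint copies of [x0] are wanted in [O], hence the last clause:
    since no point is isolated, [P] can be chosen to leave room for more. *)
Lemma place_copy O : open O -> O `&` Y !=set0 -> exists h P,
  [/\ full_group phi h, clopen P, P (h x0), P `<=` O & (O `\` P) `&` Y !=set0].
Proof.
move=> oO OY; have oOY := openI oO oY.
have [h Gh Oh] := dense0 oO OY.
have [z [[Oz Yz] /= zh]] := open_remove_nonempty (h x0) oOY OY.
have : nbhs (h x0) (O `\ z).
  apply: open_nbhs_nbhs; split; first exact: open_remove.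
  by split=> // e; apply: zh.
move=> /clopen_nbhs_base[P [cP Ph PO]].
exists h, P; split=> //; first by move=> x /PO[].
by exists z; split=> //; split=> // /PO[_]; exact.
Qed.

(** The exchange of [V] with its image under [h] and that of [B] with its
    image under [k] have disjoint supports, so their product moves both. *)
Lemma transport (h k : homeo X) (V B P Q : set X) :
  full_group phi h -> full_group phi k -> clopen V -> clopen B ->
  (forall x, V x -> P (h x)) -> (forall x, B x -> Q (k x)) ->
  (forall x, V x \/ B x -> ~ (P x \/ Q x)) -> (forall x, P x -> ~ Q x) ->
  (forall x, V x -> ~ B x) ->
  exists2 a, full_group phi a & push a (V `|` B) `<=` P `|` Q.
Proof.
move=> Gh Gk cV cB VP BQ VBPQ PQ VB.
have hV x : V x -> ~ V (h x).
  by move=> Vx Vhx; apply: (VBPQ (h x)); left => //; exact: VP.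
have kB x : B x -> ~ B (k x).
  by move=> Bx Bkx; apply: (VBPQ (k x)); right => //; exact: BQ.
exists (swap cV hV * swap cB kB).
  by apply: full_groupM; exact: full_group_swap.
set c := swap cV hV * swap cB kB; move=> x; rewrite -(homeoVK c x) pushE.
move: (homeo_fun c^-1 x) => z {x} [Vz|Bz]; rewrite homeoME.
  left; rewrite (supp_fix (@supp_swap _ _ _ cB kB)).
    by rewrite swapE //; exact: VP.
  move=> [/(VB _ Vz)//|Bz]; apply: (VBPQ z); [by left|right].
  by rewrite -(homeoVK k z); exact: BQ.
right; rewrite [swap cB kB z]swapE //; rewrite (supp_fix (@supp_swap _ _ _ cV hV)).
  exact: BQ.
move=> [Vz|Vz]; first by apply: (VBPQ (k z)); [left|right; exact: BQ].
by apply: (PQ (k z)); [rewrite -(homeoVK h (k z)); exact: VP|exact: BQ].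
Qed.

(** A stage of the construction: what is left of the given homeomorphism, a
    clopen set supporting it, and a neighbourhood of the limit point [y] in
    which all later copies are placed. *)
Record stage := Stage {
  rest : homeo X ; dom : set X ; hole : set X }.

Definition admissible (y : X) (s : stage) :=
  [/\ full_group phi (rest s), clopen (dom s), supp (rest s) `<=` dom s,
      recurs (rest s) (dom s) x0 & dom s x0] /\
  [/\ clopen (hole s), hole s y, ~ hole s x0 & ~ hole s (rest s x0)].

Definition refines (O : set X) (s t : stage) (d b a e : homeo X) :=
  [/\ rest s = rest t * (d * b * d^-1 * b^-1),
      supp d `<=` dom s, supp b `<=` dom s & dom t `<=` dom s] /\
  [/\ full_group phi d, full_group phi b, full_group phi a & full_group phi e] /\
  [/\ hole t `<=` hole s `&` O,
      push a (dom t) `|` push e (dom t) `<=` hole s `\` hole t &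
      forall x, push a (dom t) x -> ~ push e (dom t) x].

(** All sets met in one step are determined by finitely many points of the
    orbit of [x0], so a small enough [V] satisfies all requirements at
    once. *)
Lemma refinement y O s : Y y -> nbhs y O -> admissible y s ->
  exists t d b a e, admissible y t /\ refines O s t d b a e.
Proof.
case: s => [g U N] Yy yO [/= [Gg cU gU rec Ux0] [cN Ny Nx0 Ngx0]].
have [oN clN] := cN.
(* four places for copies of [x0]: the set [V `|` push g A] consists of two
   clopen pieces, and two copies of it are wanted *)
pose O1 := N `\ y; have oO1 : open O1 by exact: open_remove.
have O1Y : O1 `&` Y !=set0.
  have [|z [[Nz Yz] zy]] := @open_remove_nonempty y (N `&` Y) (openI oN oY).
    by exists y.
  by exists z.
have oD O' P : open O' -> clopen P -> open (O' `\` P).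
  by move=> oO' [_ clP]; apply: openI => //; exact: closed_openC.
have [h1 [P1 [Gh1 cP1 Ph1 PO1 OY2]]] := place_copy oO1 O1Y.
have oO2 := oD _ _ oO1 cP1.
have [h2 [P2 [Gh2 cP2 Ph2 PO2 OY3]]] := place_copy oO2 OY2.
have oO3 := oD _ _ oO2 cP2.
have [h3 [P3 [Gh3 cP3 Ph3 PO3 OY4]]] := place_copy oO3 OY3.
have oO4 := oD _ _ oO3 cP3.
have [h4 [P4 [Gh4 cP4 Ph4 PO4 _]]] := place_copy oO4 OY4.
have cnb (P : set X) x : clopen P -> P x -> nbhs x P.
  by move=> [oP _] Px; apply: open_nbhs_nbhs.
have xV : nbhs x0 [set x | [/\ U x, ~ N x, ~ N (g x) &
    [/\ P1 (h1 x), P2 (h2 x), P3 (h3 x) & P4 (h4 x)]]].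
  have cNC : clopen (~` N) by exact: (clopenC set0).
  have hP (h : homeo X) (P : set X) : clopen P -> P (h x0) ->
      nbhs x0 (h @^-1` P) by move=> cP Ph; apply: homeo_nbhs; exact: cnb.
  have nUN : nbhs x0 (U `&` ~` N `&` g @^-1` (~` N)).
    by apply: filterI; [apply: filterI; exact: cnb|exact: hP].
  have nP12 : nbhs x0 (h1 @^-1` P1 `&` h2 @^-1` P2).
    by apply: filterI; exact: hP.
  have nP34 : nbhs x0 (h3 @^-1` P3 `&` h4 @^-1` P4).
    by apply: filterI; exact: hP.
  by apply: filterS3 nUN nP12 nP34 => x [[? ?] ?] [? ?] [? ?]; split.
have [V [cV Vx0 VP]] := clopen_nbhs_base xV.
have VU : V `<=` U by move=> x /VP[].
have [g' [d [b [A [[Gg' Gd Gb] [[gE dU bU g'U recg'] [cA AV gA]]]]]]] :=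
  split_commutator Gg cU gU rec cV Vx0 VU.
set B := push g A in g'U recg'.
have cB : clopen B by exact: push_clopen.
have BE x : B x -> exists2 z, A z & x = g z.
  by move=> Bx; exists (g^-1 x) => //; rewrite homeoVK.
have VB x : V x -> ~ B x by move=> Vx /BE[z /gA] /[swap] <-.
have nN x : V x \/ B x -> ~ N x.
  move=> [/VP[_ //]|/BE[z /AV/VP[_ _ + _] ->]//].
have PO : P1 `|` P2 `|` (P3 `|` P4) `<=` O1.
  by move=> x [[/PO1|/PO2[]]|[/PO3[[]]|/PO4[[[]]]]].
have PN12 x : P1 x \/ P2 x -> N x by move=> Px; have [] := PO x (or_introl Px).
have PN34 x : P3 x \/ P4 x -> N x by move=> Px; have [] := PO x (or_intror Px).
have GgV := full_groupV Gg.
have [a Ga aP] : exists2 a, full_group phi a & push a (V `|` B) `<=` P1 `|` P2.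
  apply: (@transport h1 (h2 * g^-1)) => //.
  - exact: full_groupM.
  - by move=> x /VP[_ _ _ []].
  - by move=> x /BE[z /AV/VP[_ _ _ []] + + _ _ ->]; rewrite homeoME homeoK.
  - by move=> x /nN + /PN12.
  - by move=> x + /PO2[].
have [e Ge eP] : exists2 e, full_group phi e & push e (V `|` B) `<=` P3 `|` P4.
  apply: (@transport h3 (h4 * g^-1)) => //.
  - exact: full_groupM.
  - by move=> x /VP[_ _ _ []].
  - by move=> x /BE[z /AV/VP[_ _ _ []] + + + + ->]; rewrite homeoME homeoK.
  - by move=> x /nN + /PN34.
  - by move=> x + /PO4[].
have nyP : ~ (P1 `|` P2 `|` (P3 `|` P4)) y.
  by move=> /PO[_]; apply.
have cP : clopen (P1 `|` P2 `|` (P3 `|` P4)) by do 3?apply: clopenU.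
have yN' : nbhs y (N `&` O `&` ~` (P1 `|` P2 `|` (P3 `|` P4))).
  apply: filterI; first by apply: filterI => //; exact: cnb.
  by apply: cnb => //; exact: (clopenC set0).
have [N' [cN' N'y N'P]] := clopen_nbhs_base yN'.
have U'x0 : (V `|` B) x0 by left.
exists (Stage g' (V `|` B) N'), d, b, a, e; split; first split.
- by split=> //; exact: clopenU.
- split=> //; first by move=> /N'P[[/(nN _ U'x0)]].
  by move=> /N'P[[+ _] _]; apply: nN; exact: (supp_stable g'U).
split; [split=> //|split; [by []|split]].
- by move=> x [/VU//|/BE[z /AV/VU Uz ->]]; exact: supp_stable.
- by move=> x /N'P[].
- move=> x ae; have aPP : (P1 `|` P2 `|` (P3 `|` P4)) x.
    by case: ae => [/aP|/eP]; [left|right].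
  split; last by move=> /N'P[_].
  by case: aPP => [/PN12|/PN34].
- move=> x /aP + /eP.
  by move=> [P1x|P2x] [/PO3|/PO4]; rewrite /setD /=; tauto.
Qed.

End transport.
End cantor_like_spaces.

(** * Minimal homeomorphisms *)

Section minimality.
Context {X : topologicalType} (phi f : homeo X).
Hypotheses (minf : minimal_on_supp f).

Lemma minimal_dense x0 O : full_group phi f -> supp f x0 ->
  open O -> O `&` supp f !=set0 -> exists2 h, full_group phi h & O (h x0).
Proof.
move=> Gf fx0 oO [z [Oz fz]].
have [_ [[n _ <-] On]] := minf fx0 fz (open_nbhs_nbhs (conj oO Oz)).
exists (zexpg f n) => //; case: n {On} => k /=; first exact: full_groupX.
by apply: full_groupV; exact: full_groupX.
Qed.

Lemma supp_homeoX n x : supp f x -> supp f ((f ^+ n) x).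
Proof.
by move=> fx; elim: n => // n IH; rewrite homeoXS; exact: supp_stable IH.
Qed.

Lemma supp_homeoXV n x : supp f x -> supp f ((f ^+ n)^-1 x).
Proof.
have fnf : supp (f ^+ n) `<=` supp f.
  elim: n => [|n IH]; first by move=> z /eqP.
  by rewrite expgS; exact: supp_homeoM.
exact: supp_stable (supp_homeoV fnf).
Qed.

(** By compactness the number of steps needed to meet a neighbourhood of [x0],
    in either direction, is bounded; applied far along the orbit, this turns
    two-sided density of orbits into one-sided recurrence. *)
Lemma minimal_recurs x0 : compact (supp f) -> supp f x0 ->
  recurs f (supp f) x0.
Proof.
move=> cptf fx0 x fx V xV.
pose P (N : nat) z := exists2 j, (j <= N + N)%N & V ((f ^+ j) ((f ^+ N)^-1 z)).
have [N NP] : exists N, forall z, supp f z -> P N z.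
  have /compact_near_coveringP := cptf.
  move=> /(_ _ \oo P _)[].
    move=> z fz; have [_ [[n _ <-] Vn]] := minf fz fx0 (nbhs_interior xV).
    exists ((zexpg f n) @^-1` V°, [set N | (`|n| <= N)%N]); first split.
    - apply: homeo_nbhs; apply: open_nbhs_nbhs; split => //.
      exact: open_interior.
    - by exists `|n|%N.
    - move=> [z' N] /= [/interior_subset Vz' nN].
      case: n Vz' nN {Vn} => k /= Vz' kN.
        exists (k + N)%N; first by lia.
        by rewrite homeoXD homeoVK.
      exists (N - k.+1)%N; first by lia.
      move: Vz'; congr V; apply: (@homeo_inj _ (f ^+ k.+1)).
      by rewrite homeoVK -homeoXD subnKC // homeoVK.
  by move=> N _ NP; exists N => z; apply: NP => /=.
split.
- have [j _] := NP _ (supp_homeoX N.+1 fx).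
  by rewrite expgSr homeoME homeoK -homeoXSr => Vj; exists j.
- have [j jN Vj] := NP _ (supp_homeoXV N.+1 fx).
  exists (N + N - j)%N, ((f ^+ j) ((f ^+ N)^-1 ((f ^+ N.+1)^-1 x))) => //.
  rewrite -homeoXD; have -> : ((N + N - j).+1 + j = N.+1 + N)%N by lia.
  by rewrite homeoXD !homeoVK.
Qed.

End minimality.

Lemma three_commutators (R : realType) (X : metricType R) (phi f : homeo X) :
  cantor_like X -> full_group phi f -> clopen (supp f) -> minimal_on_supp f ->
  supp f !=set0 -> exists c1 c2 c3, [/\ commutators (full_group phi) c1,
    commutators (full_group phi) c2, commutators (full_group phi) c3 &
    f = c1 * c2 * c3].
Proof.
move=> cantorX Gf cf minf [x0 fx0]; have [of_ clf] := cf.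
have [_ cptX hX _] := cantorX.
have cptf : compact (supp f) by exact: subclosed_compact clf cptX _.
have dense0 := minimal_dense minf Gf fx0.
(* the limit point [y] of the copies must differ from [x0] and [f x0], since
   the first set of the construction contains [x0] and possibly [f x0] *)
have oQ : open (supp f `\ x0 `\ f x0) by do 2?apply: open_remove.
have [y Qy] : supp f `\ x0 `\ f x0 !=set0.
  apply: open_remove_nonempty => //; first exact: open_remove.
  by apply: open_remove_nonempty => //; exists x0.
have [N0 [cN0 N0y N0Q]] := clopen_nbhs_base cantorX (open_nbhs_nbhs (conj oQ Qy)).
have [[fy _] _] := Qy.
pose s0 := Stage f (supp f) N0.
have adm0 : admissible phi x0 y s0.
  split; first by split=> //; exact: minimal_recurs.
  by split=> //; [move=> /N0Q[[_ +] _]|move=> /N0Q[_ +]]; exact.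
pose O n : set X := ball y (n.+1%:R^-1)%R.
have yO n : nbhs y (O n).
  by apply: nbhsx_ballx; rewrite Num.Theory.invr_gt0 Num.Theory.ltr0Sn.
have /choice[next nextP] : forall ns : nat * stage, exists t : stage *
    (homeo X * homeo X * (homeo X * homeo X)), admissible phi x0 y ns.2 ->
    admissible phi x0 y t.1 /\ refines phi (O ns.1) ns.2 t.1
      t.2.1.1 t.2.1.2 t.2.2.1 t.2.2.2.
  (* a total successor function, which stays put at inadmissible stages *)
  move=> [n s] /=; have [adm|nadm] := pselect (admissible phi x0 y s); last first.
    by exists (s, (1, 1, (1, 1))).
  have [t [d [b [a [e H]]]]] := refinement cantorX cf.1 dense0 fy (yO n) adm.
  by exists (t, (d, b, (a, e))).
pose st := fix st n := if n is m.+1 then (next (m, st m)).1 else s0.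
pose data n := (next (n, st n)).2.
have adm n : admissible phi x0 y (st n).
  by elim: n => // n IH; have [] := nextP (n, st n) IH.
pose d n := (data n).1.1; pose b n := (data n).1.2.
pose a n := (data n).2.1; pose e n := (data n).2.2.
have ref n : refines phi (O n) (st n) (st n.+1) (d n) (b n) (a n) (e n).
  by have [] := nextP (n, st n) (adm n).
have holeS m n : (m <= n)%N -> hole (st n) `<=` hole (st m).
  elim: n => [|n IH]; first by rewrite leqn0 => /eqP ->.
  rewrite leq_eqVlt => /orP[/eqP -> //|/IH nm] x.
  by have [_ [_ [H _ _]]] := ref n; move=> /H[/nm].
pose EZ n := push (a n) (dom (st n.+1)) `|` push (e n) (dom (st n.+1)).
have EZhole n : EZ n `<=` hole (st n) `\` hole (st n.+1).
  by have [_ [_ []]] := ref n.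
have cdom n : clopen (dom (st n)) by have [[]] := adm n.
have nEZ : null_family y EZ.
  split.
  - by move=> n; apply: clopenU; exact: push_clopen.
  - have aux m n x : (m < n)%N -> EZ m x -> EZ n x -> False.
      by move=> mn /EZhole[_ nh] /EZhole[/(holeS _ _ mn)].
    move=> m n x Em En; have [mn|nm|//] := ltngtP m n.
      by have := aux _ _ _ mn Em En.
    by have := aux _ _ _ nm En Em.
  - by move=> n /EZhole[_]; apply; have [_ []] := adm n.+1.
  - move=> Q /nbhs_ballP[r /= r0 rQ].
    have [M _ MP] := near_infty_natSinv_lt (PosNum r0).
    exists M.+1 => n Mn x /EZhole[/(holeS _ _ Mn) xh _].
    apply: rQ; have [_ [_ [/(_ x xh)[_ Ox] _ _]]] := ref M.
    by apply: le_ball Ox; apply: Order.POrderTheory.ltW; apply: MP => /=.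
(* the first splitting is set aside, because the support of [f] itself has
   not been carried near [y] *)
have [] := @swindle X phi y (fun n => rest (st n.+1)) (fun n => d n.+1)
    (fun n => b n.+1) a e (fun n => dom (st n.+1)) => //.
- by move=> n; have [[]] := adm n.+1.
- by move=> n; have [_ [[]]] := ref n.+1.
- by move=> n; have [_ [[]]] := ref n.+1.
- by move=> n; have [_ [[]]] := ref n.
- by move=> n; have [_ [[]]] := ref n.
- by move=> n; have [[]] := ref n.+1.
- by move=> n; have [[]] := adm n.+1.
- by move=> n; have [[]] := ref n.+1.
- by move=> n; have [[]] := ref n.+1.
- by move=> n; have [[]] := ref n.+1.
- by move=> n x; have [_ [_ [_ _]]] := ref n; exact.
move=> c1 [c2 [c1P c2P cE]].
have [[fE _ _ _] [[Gd Gb _ _] _]] := ref 0%N.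
exists c1, c2, (d 0%N * b 0%N * (d 0%N)^-1 * (b 0%N)^-1); split=> //.
  by exists (d 0%N) => //; exists (b 0%N).
by rewrite -cE; exact: fE.
Qed.

(** The orbit of a fixed point is reduced to it, hence not dense. *)
Lemma minimal_suppT (R : realType) (X : metricType R) (phi : homeo X) :
  cantor_like X -> minimal_homeo phi -> supp phi = setT.
Proof.
move=> cantorX minphi; have [pX _ hX _] := cantorX.
apply/seteqP; split=> // x _; apply/eqP => phix.
have orb1 z : orbit_of phi x z -> z = x.
  move=> /orbit_ofP[m [n e]]; have fixX k : (phi ^+ k) x = x.
    by elim: k => // k IH; rewrite homeoXS IH.
  by apply: (@homeo_inj _ (phi ^+ n)); rewrite -e !fixX.
have oC : open ([set: X] `\ x) by apply: open_remove => //; exact: openT.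
have nC : [set: X] `\ x !=set0.
  by apply: open_remove_nonempty => //; [exact: openT|exists x].
by have [z [[_ zx] /orb1]] := minphi x _ nC oC.
Qed.

Theorem theorem4p6 (R : realType) (X : metricType R) (phi : homeo X) :
  cantor_minimal_system phi ->
  (forall f : homeo X,
     full_group phi f -> clopen (supp f) -> minimal_on_supp f ->
     derived_subgroup (full_group phi) f /\
     exists c : 'I_5 -> homeo X,
       (forall i, commutators (full_group phi) (c i)) /\
       f = \prod_(i < 5) c i) /\
  derived_subgroup (full_group phi) phi.
Proof.
move=> [[X0 cantorX] minphi].
have comm1 : commutators (full_group phi) 1.
  have G1 := full_group1 phi; exists 1 => //; exists 1 => //.
  by rewrite invg1 !mulg1.
have decomposition f : full_group phi f -> clopen (supp f) -> minimal_on_supp f ->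
    exists c1 c2 c3, [/\ commutators (full_group phi) c1,
      commutators (full_group phi) c2, commutators (full_group phi) c3 &
      f = c1 * c2 * c3].
  move=> Gf cf minf; have [f0|/set0P/(three_commutators cantorX Gf cf minf)//] :=
    eqVneq (supp f) set0.
  exists 1, 1, 1; split=> //; rewrite !mulg1; apply: homeo_ext => x.
  by apply: (@supp_fix _ f set0) => //; rewrite f0.
have main f : full_group phi f -> clopen (supp f) -> minimal_on_supp f ->
    derived_subgroup (full_group phi) f /\
    exists c : 'I_5 -> homeo X,
      (forall i, commutators (full_group phi) (c i)) /\ f = \prod_(i < 5) c i.
  move=> Gf cf minf.
  have [c1 [c2 [c3 [C1 C2 C3 fE]]]] := decomposition f Gf cf minf.
  split.
    move=> H [/subgroupP[_ HM _] CH]; rewrite fE.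
    exact: (HM _ _ (HM _ _ (CH _ C1) (CH _ C2)) (CH _ C3)).
  (* the default value of [nth] supplies the two trivial commutators *)
  exists (fun i => nth 1 [:: c1; c2; c3] i); split.
    by case=> -[|[|[|[|[|i]]]]].
  by rewrite !big_ord_recl big_ord0 /= !mulg1 mulgA.
split; first exact: main.
have suppT := minimal_suppT cantorX minphi.
apply: (main phi _ _ _).1.
- by move=> x; exists 1%Z.
- by rewrite suppT; exact: clopenT.
- move=> x _ z _ O zO.
  have [|w [Ow xw]] := minphi x O° _ (open_interior _).
    by exists z.
  by exists w; split=> //; exact: interior_subset.
Qed.
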